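(* Let $T=T(\omega,\eta)$ be a set of twins in $X$ with $|T|\geq 2$. Let $\theta=\alpha+\beta\deg(u)+\gamma(\omega-\eta)$ if $M=\mathbf{A}$, and $\theta=\alpha+\frac{\gamma(\omega-\eta)}{\deg(u)}$ if $M=\mathcal{A}$, where $u\in T$ (the value does not depend on the choice of $u\in T$, and $\theta$ is an eigenvalue of $M$). The following statements hold with respect to $M$. 1. Let $u,v\in T$. If $\Omega$ is an orthogonal set of eigenvectors for $\theta$ such that $\mathbf{e}_u-\mathbf{e}_v\in\Omega$, then $E_\theta\mathbf{e}_u=cE_\theta\mathbf{e}_v$ if and only if $c=-1$. Moreover, if $E_\theta\mathbf{e}_u=-E_\theta\mathbf{e}_v$, then $|T|=2$ and either $|\Omega|=1$ or $\mathbf{w}^T\mathbf{e}_u=\mathbf{w}^T\mathbf{e}_v=0$ for all $\mathbf{w}\in\Omega\setminus\{\mathbf{e}_u-\mathbf{e}_v\}$. 2. If $u\in T$ and $v\in V(X)\setminus T$, then $E_\theta\mathbf{e}_u\neq cE_\theta\mathbf{e}_v$ for any $c\in\mathbb{R}$. 3. For all $\mu\in\sigma_u(M)$ with $\mu\neq\theta$, $E_\mu\mathbf{e}_u=E_\mu\mathbf{e}_v$ for all $u,v\in T$.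
   Context: $X$ is a finite connected undirected graph with nonzero real edge weights, loops allowed, no multiple edges. $A$ is its adjacency matrix: $(A)_{j,\ell}$ is the weight of the edge $(j,\ell)$ (for $j=\ell$, the weight of the loop at $j$), and $0$ if there is no such edge. $\deg(u)=2(A)_{u,u}+\sum_{j\neq u}(A)_{u,j}$ and $D$ is the diagonal matrix of degrees. $\mathbf{e}_u$ is the characteristic vector of $u$. Fix real $\alpha,\beta,\gamma$ with $\gamma\neq0$. The generalized adjacency matrix is $\mathbf{A}=\alpha I+\beta D+\gamma A$. If all vertex degrees are positive or all are negative, the generalized normalized adjacency matrix is $\mathcal{A}=\alpha I+\gamma D^{-1/2}AD^{-1/2}$, where $D^{-1/2}$ is diagonal with $(D^{-1/2})_{u,u}=1/\sqrt{\deg(u)}$ if $\deg(u)>0$ and $-i/\sqrt{|\deg(u)|}$ if $\deg(u)<0$. $M$ denotes $\mathbf{A}$ or, when it is defined, $\mathcal{A}$; both are real symmetric. For an eigenvalue $\lambda$ of $M$, $E_\lambda$ is the orthogonal projection onto its eigenspace, and $\sigma_u(M)=\{\lambda:E_\lambda\mathbf{e}_u\neq0\}$. Two vertices $u,v$ are twins if they have the same neighbours outside $\{u,v\}$, the edges $(u,w)$ and $(v,w)$ have the same weight for each common neighbour $w\notin\{u,v\}$, and, if there are loops on $u$ and $v$, these have the same weight. A set of twins $T=T(\omega,\eta)$, with $\omega,\eta\in\mathbb{R}$, is a set $T\subseteq V(X)$ such that any two vertices of $T$ are twins, each vertex of $T$ has a loop of weight $\omega$ (no loop if $\omega=0$),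 and every two distinct vertices of $T$ are joined by an edge of weight $\eta$ (not adjacent if $\eta=0$).
   Formalization: In part 1, ''if and only if c=-1'' is read as: the relation E_θe_u = cE_θe_v can hold only with c=-1. The converse (c=-1 forces E_θe_u = -E_θe_v) is not claimed, since it is false, e.g. for the unweighted K_3 with T=V. *)

(* Defs.v *)
From HB Require Import structures.
From mathcomp Require Export all_boot all_order all_algebra.
From mathcomp Require Export complex.
From mathcomp Require Export boolp classical_sets functions cardinality reals.

Set Implicit Arguments.
Unset Strict Implicit.
Unset Printing Implicit Defensive.

Import Order.TTheory GRing.Theory Num.Theory.
Local Open Scope ring_scope.
Local Open Scope complex_scope.

(* Values of [wt] off the edge relation are junk: they are ignored by [adjmx]
   and by every definition below. *)
Record wgraph (R : realType) (n : nat) := WGraph {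
  edge : rel 'I_n;
  wt : 'I_n -> 'I_n -> R;
  edge_sym : symmetric edge;
  wt_sym : forall u v, wt u v = wt v u;
  wt_neq0 : forall u v, edge u v -> wt u v != 0
}.

Section Graph.
Variables (R : realType) (n : nat) (X : wgraph R n).

Definition connected_graph := forall u v : 'I_n, connect (edge X) u v.

Definition adjmx : 'M[R]_n :=
  \matrix_(j, l) (if edge X j l then wt X j l else 0).

Definition deg (u : 'I_n) : R :=
  2 * adjmx u u + \sum_(j < n | j != u) adjmx u j.

Definition degmx : 'M[R]_n := diag_mx (\row_u deg u).

Definition same_sign_degrees :=
  (forall u, 0 < deg u) \/ (forall u, deg u < 0).

Definition gen_adjmx (alpha beta gamma : R) : 'M[R]_n :=
  alpha%:M + beta *: degmx + gamma *: adjmx.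

Definition inv_sqrt_degmx : 'M[R[i]]_n :=
  diag_mx (\row_u (if 0 < deg u then ((Num.sqrt (deg u))^-1)%:C
                   else - 'i * ((Num.sqrt `|deg u|)^-1)%:C)).

Definition gen_norm_adjmxC (alpha gamma : R) : 'M[R[i]]_n :=
  (alpha%:C)%:M +
  gamma%:C *: (inv_sqrt_degmx *m map_mx (real_complex R) adjmx *m inv_sqrt_degmx).

(* The same matrix with real entries; taking real parts loses nothing when the
   degrees have the same sign, see [gen_norm_adjmxE]. *)
Definition gen_norm_adjmx (alpha gamma : R) : 'M[R]_n :=
  map_mx (@complex.Re R) (gen_norm_adjmxC alpha gamma).

Lemma adjmx_sym : adjmx^T = adjmx.
Proof. by apply/matrixP=> u v; rewrite !mxE edge_sym wt_sym. Qed.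

Lemma gen_adjmx_sym alpha beta gamma :
  (gen_adjmx alpha beta gamma)^T = gen_adjmx alpha beta gamma.
Proof.
by rewrite /gen_adjmx !linearD /= tr_scalar_mx !linearZ /= tr_diag_mx adjmx_sym.
Qed.

Lemma gen_norm_adjmxE alpha gamma : same_sign_degrees ->
  map_mx (real_complex R) (gen_norm_adjmx alpha gamma) =
  gen_norm_adjmxC alpha gamma.
Proof.
move=> sgn; apply/matrixP=> u v.
rewrite /gen_norm_adjmx /gen_norm_adjmxC /inv_sqrt_degmx.
rewrite mul_diag_mx mul_mx_diag !mxE.
move: (if edge X u v then _ else _) => a.
case: sgn => sgn.
  rewrite !sgn; case: (u == v); rewrite ?mulr1n ?mulr0n;
  by simpc; rewrite ?(mul0r, mulr0, addr0, subr0).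
rewrite ![0 < _]ltNge !ltW ?sgn //=; case: (u == v); rewrite ?mulr1n ?mulr0n;
by simpc; rewrite ?(mul0r, mulr0, addr0, subr0, oppr0).
Qed.

Lemma gen_norm_adjmx_sym alpha gamma :
  (gen_norm_adjmx alpha gamma)^T = gen_norm_adjmx alpha gamma.
Proof.
rewrite /gen_norm_adjmx map_trmx; congr map_mx.
rewrite /gen_norm_adjmxC linearD /= tr_scalar_mx linearZ /= !trmx_mul.
by rewrite /inv_sqrt_degmx !tr_diag_mx map_trmx adjmx_sym mulmxA.
Qed.

Definition twins (u v : 'I_n) :=
  [/\ forall w, w != u -> w != v -> edge X u w = edge X v w,
      forall w, w != u -> w != v -> edge X u w -> edge X v w ->
        wt X u w = wt X v w
    & edge X u u -> edge X v v -> wt X u u = wt X v v].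

Definition edge_of_weight (u v : 'I_n) (x : R) :=
  if x == 0 then ~~ edge X u v else edge X u v && (wt X u v == x).

Definition twin_set (T : {set 'I_n}) (omega eta : R) :=
  [/\ forall u v, u \in T -> v \in T -> u != v -> twins u v,
      forall u, u \in T -> edge_of_weight u u omega
    & forall u v, u \in T -> v \in T -> u != v -> edge_of_weight u v eta].

End Graph.

Variant matrix_kind := GenAdj | GenNormAdj.

Section Kind.
Variables (R : realType) (n : nat) (X : wgraph R n) (alpha beta gamma : R).

Definition kind_defined (k : matrix_kind) :=
  if k is GenNormAdj then same_sign_degrees X else True.

Definition kind_mx (k : matrix_kind) : 'M[R]_n :=
  match k with
  | GenAdj => gen_adjmx X alpha beta gamma
  | GenNormAdj => gen_norm_adjmx X alpha gamma
  end.

Definition twin_eigenvalue (k : matrix_kind) (omega eta : R) (u : 'I_n) : R :=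
  match k with
  | GenAdj => alpha + beta * deg X u + gamma * (omega - eta)
  | GenNormAdj => alpha + gamma * (omega - eta) / deg X u
  end.

End Kind.

Section Spectral.
Variables (R : realType) (n : nat).
Implicit Types (M : 'M[R]_n) (W : 'M[R]_n) (u : 'I_n) (w : 'cV[R]_n).

Definition evec u : 'cV[R]_n := delta_mx u 0.

(* MathComp's [eigenspace] and [proj_mx] act on row vectors, whence the final
   transposition; [kermx W^T] is the orthogonal complement of the row space
   of W. *)
Definition eigenproj M (lambda : R) : 'M[R]_n :=
  (proj_mx (eigenspace M lambda) (kermx (eigenspace M lambda)^T))^T.

Definition eigen_support M u : set R :=
  [set lambda | eigenvalue M lambda /\ eigenproj M lambda *m evec u <> 0]%classic.

Definition is_eigenvector M (lambda : R) w :=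
  w <> 0 /\ M *m w = lambda *: w.

Definition orthogonal_eigenset M (lambda : R) (Omega : set 'cV[R]_n) :=
  (forall w, Omega w -> is_eigenvector M lambda w) /\
  (forall w w', Omega w -> Omega w' -> w <> w' -> w^T *m w' = 0).

Lemma capmx_orth W : (W :&: kermx W^T = 0)%MS.
Proof.
apply/eqP/rowV0P=> v; rewrite sub_capmx => /andP[/submxP[a va]] /sub_kermxP vW.
have vv : v *m v^T = 0 by rewrite {2}va trmx_mul mulmxA vW mul0mx.
apply/rowP=> j; move/matrixP: vv => /(_ 0 0); rewrite !mxE.
under eq_bigr do rewrite !mxE -expr2.
move/eqP; rewrite psumr_eq0 => [/allP/(_ j (mem_index_enum _))|i _]; last first.
  exact: sqr_ge0.
by rewrite sqrf_eq0 => /eqP.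
Qed.

Lemma addsmx_orth W : (1%:M <= W + kermx W^T)%MS.
Proof.
rewrite submx_full // /row_full.
have := mxrank_sum_cap W (kermx W^T).
rewrite capmx_orth mxrank0 addn0 => ->.
by rewrite mxrank_ker mxrank_tr subnKC // rank_leq_row.
Qed.

Lemma eigenspace_colP M lambda w : M^T = M ->
  reflect (M *m w = lambda *: w) (w^T <= eigenspace M lambda)%MS.
Proof.
move=> symM; apply: (iffP eigenspaceP).
  by move/(congr1 trmx); rewrite linearZ /= trmx_mul symM !trmxK.
by move/(congr1 trmx); rewrite linearZ /= trmx_mul symM.
Qed.

(* [eigenproj_eigen], [eigenproj_id] and [eigenproj_orth] characterize
   [eigenproj M lambda] as the orthogonal projection onto the
   lambda-eigenspace of a symmetric matrix. *)
Lemma eigenproj_eigen M lambda w : M^T = M ->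
  M *m (eigenproj M lambda *m w) = lambda *: (eigenproj M lambda *m w).
Proof.
by move=> symM; apply/eigenspace_colP => //; rewrite trmx_mul trmxK proj_mx_sub.
Qed.

Lemma eigenproj_id M lambda w : M^T = M ->
  M *m w = lambda *: w -> eigenproj M lambda *m w = w.
Proof.
move=> symM /(eigenspace_colP _ _ symM) wE; apply: trmx_inj.
by rewrite trmx_mul trmxK proj_mx_id // capmx_orth.
Qed.

Lemma eigenproj_orth M lambda w w' : M^T = M ->
  M *m w' = lambda *: w' -> (w - eigenproj M lambda *m w)^T *m w' = 0.
Proof.
move=> symM /(eigenspace_colP _ _ symM) /submxP[a w'E].
have kE : (w^T - w^T *m proj_mx (eigenspace M lambda)
   (kermx (eigenspace M lambda)^T)) *m (eigenspace M lambda)^T = 0.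
  apply/sub_kermxP/proj_mx_compl_sub; apply: submx_trans (addsmx_orth _).
  exact: submx1.
have w'T : w' = (eigenspace M lambda)^T *m a^T by rewrite -trmx_mul -w'E trmxK.
by rewrite linearB /= [(_ *m w)^T]trmx_mul trmxK w'T mulmxA kE mul0mx.
Qed.

End Spectral.

(* Main.v *)
Require Import Defs.
From mathcomp Require Import ring lra.
Set Implicit Arguments.
Unset Strict Implicit.
Unset Printing Implicit Defensive.

Import Order.TTheory GRing.Theory Num.Theory.
Local Open Scope ring_scope.

(** Swapping two vertices u and v of T leaves the adjacency matrix A unchanged,
    hence also both matrices M, so that e_u - e_v is an eigenvector of M; its
    eigenvalue is M u u - M u v, which is theta ([twin_difference_eigen]).  For
    the normalized matrix this rests on the entries of D^(-1/2) A D^(-1/2) being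
    A u v / (sqrt |deg u| sqrt |deg v|) up to the common sign of the degrees
    ([gen_norm_adjmx_entry]), and on the vertices of T having equal degrees
    ([twin_set_deg]).

    The rest is linear algebra of a symmetric M that has such eigenvectors.
    An orthogonal projection does not change inner products with vectors of its
    range, so E e_u = c E e_v forces w u = c * w v for every w in the eigenspace
    ([eigenproj_evec_parallel]).  Each claim on E theta comes from a good choice
    of w:
    - w = e_u - e_v gives c = -1 when u and v are both in T;
    - w = e_u - e_z, with z a third vertex of T, contradicts c = -1;
    - an eigenvector w orthogonal to e_u - e_v satisfies w u = w v, which with
      w u = - w v makes both entries vanish;
    - w = e_u - e_z, with z in T other than u, gives 1 = 0 when v is outside T.
    For mu <> theta, the eigenvector e_u - e_v is orthogonal to the
    mu-eigenspace, so that E mu annihilates it ([eigenproj_other]). *)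

(** * Eigenprojections of a symmetric matrix *)

Section SymmetricMatrix.
Variables (R : realType) (n : nat).
Implicit Types (M : 'M[R]_n) (u v z : 'I_n) (w : 'cV[R]_n).

Lemma evec_subE u v z : (evec R u - evec R v) z 0 = (z == u)%:R - (z == v)%:R.
Proof. by rewrite !mxE !eqxx !andbT. Qed.

Lemma mul_evec M u z : (M *m evec R u) z 0 = M z u.
Proof. by rewrite /evec -colE mxE. Qed.

Lemma dot_evec w u : w^T *m evec R u = (w u 0)%:M.
Proof. by rewrite [LHS]mx11_scalar /evec -colE !mxE. Qed.

Lemma evec_dot w u : (evec R u)^T *m w = (w u 0)%:M.
Proof. by apply: trmx_inj; rewrite trmx_mul trmxK dot_evec tr_scalar_mx. Qed.

Lemma dotmx_eq0 w : w^T *m w = 0 -> w = 0.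
Proof.
move=> /matrixP/(_ 0 0); rewrite !mxE; under eq_bigr do rewrite mxE -expr2.
move/eqP; rewrite psumr_eq0 => [/allP w0|i _]; last exact: sqr_ge0.
apply/colP=> j; rewrite mxE; apply/eqP.
by have := w0 j (mem_index_enum _); rewrite sqrf_eq0.
Qed.

Lemma evec_sub_neq0 u v : u != v -> evec R u - evec R v <> 0.
Proof.
move=> /negbTE uv /matrixP/(_ u 0); rewrite evec_subE mxE eqxx uv subr0.
by move/eqP; rewrite oner_eq0.
Qed.

(** For a symmetric M the hypotheses say that the transposition of u and v
    fixes M: e_u - e_v spans the vectors supported on {u, v} that it negates. *)
Lemma evec_sub_eigen M lambda u v : u != v ->
  M u u - M u v = lambda -> M v v - M v u = lambda ->
  (forall z, z != u -> z != v -> M z u = M z v) ->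
  M *m (evec R u - evec R v) = lambda *: (evec R u - evec R v).
Proof.
move=> uv Mu Mv Mz; apply/colP=> z.
rewrite mulmxBr [LHS]mxE [X in _ + X]mxE !mul_evec [RHS]mxE evec_subE.
have [->|zu] := eqVneq z u; first by rewrite (negbTE uv) subr0 mulr1.
have [->|zv] := eqVneq z v; first by rewrite sub0r mulrN1 -Mv opprB.
by rewrite Mz // subrr subr0 mulr0.
Qed.

Lemma eigenproj_dot M lambda w w' : M^T = M -> M *m w' = lambda *: w' ->
  (eigenproj M lambda *m w)^T *m w' = w^T *m w'.
Proof.
move=> symM Mw'; have /eqP := eigenproj_orth w symM Mw'.
by rewrite linearB /= mulmxBl subr_eq0 => /eqP.
Qed.

(** Both sides are inner products with w, which the projection preserves. *)
Lemma eigenproj_evec_parallel M lambda c u v w :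
  M^T = M -> M *m w = lambda *: w ->
  eigenproj M lambda *m evec R u = c *: (eigenproj M lambda *m evec R v) ->
  w u 0 = c * w v 0.
Proof.
move=> symM Mw /(congr1 (fun x => x^T *m w)).
rewrite linearZ /= -scalemxAl !eigenproj_dot // !evec_dot.
by move=> /matrixP/(_ 0 0); rewrite !mxE !mulr1n.
Qed.

Lemma eigen_orth M lambda mu w w' : M^T = M ->
  M *m w = lambda *: w -> M *m w' = mu *: w' -> mu <> lambda -> w^T *m w' = 0.
Proof.
move=> symM Mw Mw' /eqP; rewrite -subr_eq0 => neq; apply/eqP.
(* mu and lambda both multiply the inner product into w^T M w' *)
have /eqP : (mu - lambda) *: (w^T *m w') = 0.
  rewrite scalerBl scalemxAr -Mw' scalemxAl.
  have -> : lambda *: w^T = (lambda *: w)^T by rewrite linearZ.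
  by rewrite -Mw trmx_mul symM mulmxA subrr.
by rewrite scaler_eq0 (negbTE neq).
Qed.

Lemma eigenproj_other M lambda mu w : M^T = M ->
  M *m w = lambda *: w -> mu <> lambda -> eigenproj M mu *m w = 0.
Proof.
move=> symM Mw neq; have MEw := eigenproj_eigen mu w symM.
(* |E w|^2 = <w, E w>, and E w lies in another eigenspace than w *)
by apply: dotmx_eq0; rewrite (eigenproj_dot _ symM MEw) (eigen_orth symM Mw MEw).
Qed.

End SymmetricMatrix.

(** * Twins give eigenvectors *)

Section Twins.
Variables (R : realType) (n : nat) (X : wgraph R n).
Implicit Types (u v z : 'I_n) (k : matrix_kind).

Lemma edge_of_weight_adjmx u v x : edge_of_weight X u v x -> adjmx X u v = x.
Proof.
rewrite /edge_of_weight mxE.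
by case: eqP => [-> /negbTE->|_ /andP[-> /eqP]].
Qed.

Lemma twins_adjmx u v z : twins X u v -> z != u -> z != v ->
  adjmx X z u = adjmx X z v.
Proof.
move=> [tE tW _] zu zv; rewrite -(adjmx_sym X) !mxE (tE z zu zv).
by case: ifP => // vz; rewrite (tW z) ?tE.
Qed.

(** The square roots of the two degrees enter the complex matrix with factors
    1 * 1 or (- i) * (- i), that is, the common sign of the degrees. *)
Lemma gen_norm_adjmx_entry alpha gamma u v : same_sign_degrees X ->
  gen_norm_adjmx X alpha gamma u v = alpha *+ (u == v) +
    gamma * (Num.sg (deg X u) * adjmx X u v /
             (Num.sqrt `|deg X u| * Num.sqrt `|deg X v|)).
Proof.
move=> sgn; rewrite /gen_norm_adjmx /gen_norm_adjmxC /inv_sqrt_degmx.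
rewrite mul_diag_mx mul_mx_diag !mxE invfM.
move: (if edge X u v then _ else _) => a.
case: sgn => sgn.
  rewrite !sgn gtr0_sg // !gtr0_norm //; case: (u == v);
  rewrite ?mulr1n ?mulr0n /=; ring.
rewrite ![0 < _]ltNge !ltW ?sgn //= ltr0_sg //; case: (u == v);
rewrite ?mulr1n ?mulr0n /=; ring.
Qed.

Lemma kind_mx_sym alpha beta gamma k :
  (kind_mx X alpha beta gamma k)^T = kind_mx X alpha beta gamma k.
Proof. by case: k; [exact: gen_adjmx_sym | exact: gen_norm_adjmx_sym]. Qed.

Variables (T : {set 'I_n}) (omega eta : R).
Hypothesis T_twins : twin_set X T omega eta.

Lemma twin_set_deg u v : u \in T -> v \in T -> deg X u = deg X v.
Proof.
move=> uT vT; have [->//|uv] := eqVneq u v.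
have [tw loop adj] := T_twins.
have vu : v != u by rewrite eq_sym.
rewrite /deg !(edge_of_weight_adjmx (loop _ _)) //; congr (_ + _).
rewrite (bigD1 v) //= [RHS](bigD1 u) //=.
rewrite !(edge_of_weight_adjmx (adj _ _ _ _ _)) //; congr (_ + _).
apply: eq_big => [z|z /andP[zu zv]]; first exact: andbC.
by rewrite -(adjmx_sym X) 2![_^T _ _]mxE (twins_adjmx (tw u v uT vT uv)).
Qed.

Lemma twin_eigenvalue_eq alpha beta gamma k u v : u \in T -> v \in T ->
  twin_eigenvalue X alpha beta gamma k omega eta u =
  twin_eigenvalue X alpha beta gamma k omega eta v.
Proof. by move=> uT vT; case: k; rewrite /= (twin_set_deg uT vT). Qed.

Lemma kind_mx_twins alpha beta gamma k u v z : kind_defined X k ->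
  u \in T -> v \in T -> u != v -> z != u -> z != v ->
  kind_mx X alpha beta gamma k z u = kind_mx X alpha beta gamma k z v.
Proof.
move=> kd uT vT uv zu zv; have [tw _ _] := T_twins.
have adjE := twins_adjmx (tw u v uT vT uv) zu zv.
case: k kd => [_|sgn] /=.
  rewrite /gen_adjmx /degmx; move: (adjmx X) adjE => A adjE.
  by rewrite !mxE adjE (negbTE zu) (negbTE zv).
rewrite !gen_norm_adjmx_entry // (negbTE zu) (negbTE zv) adjE.
by rewrite (twin_set_deg uT vT).
Qed.

Lemma kind_mx_twin_eigenvalue alpha beta gamma k u v : kind_defined X k ->
  u \in T -> v \in T -> u != v ->
  kind_mx X alpha beta gamma k u u - kind_mx X alpha beta gamma k u v =
  twin_eigenvalue X alpha beta gamma k omega eta u.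
Proof.
move=> kd uT vT uv; have [_ loop adj] := T_twins.
have Auu := edge_of_weight_adjmx (loop u uT).
have Auv := edge_of_weight_adjmx (adj u v uT vT uv).
case: k kd => [_|sgn] /=.
  rewrite /gen_adjmx /degmx; move: (adjmx X) Auu Auv => A Auu Auv.
  by rewrite !mxE Auu Auv eqxx (negbTE uv) !mulr1n !mulr0n; ring.
rewrite !gen_norm_adjmx_entry // eqxx (negbTE uv) Auu Auv -(twin_set_deg uT vT).
rewrite -expr2 sqr_sqrtr ?normr_ge0 //.
have d0 : deg X u != 0 by case: sgn => /(_ u); [move/gt_eqF|move/lt_eqF] => ->.
(* sg d / |d| = 1 / d *)
have -> : `|deg X u| = Num.sg (deg X u) * deg X u by rewrite normrEsg.
have s0 : Num.sg (deg X u) != 0 by rewrite sgr_eq0.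
by rewrite mulr1n mulr0n; field; rewrite d0 s0.
Qed.

Lemma twin_difference_eigen alpha beta gamma k u u0 v : kind_defined X k ->
  u0 \in T -> u \in T -> v \in T -> u != v ->
  kind_mx X alpha beta gamma k *m (evec R u - evec R v) =
  twin_eigenvalue X alpha beta gamma k omega eta u0 *: (evec R u - evec R v).
Proof.
move=> kd u0T uT vT uv; apply: evec_sub_eigen => //.
- by rewrite kind_mx_twin_eigenvalue //; apply: twin_eigenvalue_eq.
- rewrite kind_mx_twin_eigenvalue //; last by rewrite eq_sym.
  exact: twin_eigenvalue_eq.
- by move=> z zu zv; apply: kind_mx_twins.
Qed.

End Twins.

(** * Eigenprojections of twins *)

Theorem theorem3p9 (R : realType) (n : nat) (X : wgraph R n)
    (Xconn : connected_graph X)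
    (alpha beta gamma : R) (gamma_neq0 : gamma != 0)
    (k : matrix_kind) (k_def : kind_defined X k)
    (T : {set 'I_n}) (omega eta : R)
    (T_twins : twin_set X T omega eta) (T_ge2 : (2 <= #|T|)%N) :
  let M := kind_mx X alpha beta gamma k in
  let E := eigenproj M in
  (forall u v, u \in T -> v \in T ->
     twin_eigenvalue X alpha beta gamma k omega eta u =
     twin_eigenvalue X alpha beta gamma k omega eta v) /\
  forall u0, u0 \in T ->
  let theta := twin_eigenvalue X alpha beta gamma k omega eta u0 in
  [/\ eigenvalue M theta,
      (forall u v, u \in T -> v \in T -> forall Omega : set 'cV[R]_n,
         orthogonal_eigenset M theta Omega ->
         Omega (evec R u - evec R v) ->
         (forall c : R,
            E theta *m evec R u = c *: (E theta *m evec R v) <->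
            c = -1 /\ E theta *m evec R u = - (E theta *m evec R v)) /\
         (E theta *m evec R u = - (E theta *m evec R v) ->
            #|T| = 2%N /\
            ((Omega #= `I_1)%card \/
             forall w, Omega w -> w <> evec R u - evec R v ->
               w^T *m evec R u = 0 /\ w^T *m evec R v = 0))),
      (forall u v, u \in T -> v \notin T -> forall c : R,
         E theta *m evec R u <> c *: (E theta *m evec R v))
    & (forall u, u \in T -> forall mu, eigen_support M u mu -> mu <> theta ->
         forall v, v \in T -> E mu *m evec R u = E mu *m evec R v)].
Proof.
move=> M E; split=> [u v uT vT|u0 u0T theta].
  exact: (twin_eigenvalue_eq T_twins).
have symM : M^T = M := kind_mx_sym X alpha beta gamma k.
have twinM u v : u \in T -> v \in T -> u != v ->
    M *m (evec R u - evec R v) = theta *: (evec R u - evec R v).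
  by move=> *; apply: (twin_difference_eigen T_twins).
have other u : u \in T -> exists2 v, v \in T & u != v.
  move=> uT; have /card_gt0P[v] : (0 < #|T :\ u|)%N.
    by move: T_ge2; rewrite (cardsD1 u) uT.
  by rewrite !inE => /andP[vu vT]; exists v; rewrite // eq_sym.
split.
- have [v vT u0v] := other u0 u0T.
  apply/eigenvalueP; exists (evec R u0 - evec R v)^T.
    by apply: trmx_inj; rewrite trmx_mul linearZ /= !trmxK symM twinM.
  by rewrite trmx_eq0; apply/eqP/evec_sub_neq0.
- move=> u v uT vT Omega [eigOmega orthOmega] uvOmega.
  have uv : u != v.
    apply/eqP=> uv; have [] := eigOmega _ uvOmega.
    by rewrite uv subrr.
  split=> [c|].
    split=> [Euv|[-> Euv]]; last by rewrite scaleN1r.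
    have := eigenproj_evec_parallel symM (twinM u v uT vT uv) Euv.
    rewrite !evec_subE !eqxx (negbTE uv) eq_sym (negbTE uv) /= => cE.
    have c1 : c = -1 by lra.
    by split=> //; rewrite Euv c1 scaleN1r.
  rewrite -[- (_ *m _)]scaleN1r => Euv.
  have entries (w : 'cV[R]_n) : M *m w = theta *: w -> w u 0 = -1 * w v 0.
    by move=> Mw; apply: eigenproj_evec_parallel symM Mw Euv.
  split.
    have T2 : T = [set u; v].
      apply/setP=> z; rewrite !inE; apply/idP/orP=> [zT|[]/eqP-> //].
      have [|zu] := eqVneq z u; first by left.
      have [|zv] := eqVneq z v; first by right.
      have uz : u != z by rewrite eq_sym.
      have := entries _ (twinM u z uT zT uz); rewrite !evec_subE eqxx.
      rewrite (negbTE uz) (eq_sym v u) (negbTE uv) (eq_sym v z) (negbTE zv).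
      by rewrite !subr0 mulr0 => /eqP; rewrite oner_eq0.
    by rewrite T2 cards2 uv.
  (* w u = w v by orthogonality to e_u - e_v, and w u = - w v by [entries] *)
  right=> w wOmega w_neq; have [_ Mw] := eigOmega _ wOmega.
  have /matrixP/(_ 0 0) := orthOmega _ _ wOmega uvOmega w_neq.
  rewrite mulmxBr !dot_evec !mxE !mulr1n => w_uv; have := entries w Mw => w_uv'.
  have [-> ->] : w u 0 = 0 /\ w v 0 = 0 by split; lra.
  by rewrite raddf0.
- move=> u v uT vT c Euv; have [z zT uz] := other u uT.
  have := eigenproj_evec_parallel symM (twinM u z uT zT uz) Euv.
  have /negbTE vu : v != u by apply: contraNneq vT => ->.
  have /negbTE vz : v != z by apply: contraNneq vT => ->.
  rewrite !evec_subE eqxx (negbTE uz) vu vz !subr0 mulr0.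
  by move/eqP; rewrite oner_eq0.
- move=> u uT mu _ mu_neq v vT; have [->//|uv] := eqVneq u v.
  apply/eqP; rewrite -subr_eq0 -mulmxBr.
  by rewrite (eigenproj_other symM (twinM u v uT vT uv)).
Qed.
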